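(* Let $A$ be a totally filled $n\times m$ toroidal array, i.e. every cell is filled. Then $P(A)$ has a solution if and only if $n$ and $m$ are not both even.
   Context: Arrays are toroidal: an $n\times m$ array $A$ has rows indexed modulo $n$ and columns modulo $m$ (representatives $1,\dots,n$ and $1,\dots,m$). Each cell is either filled or empty, and $F(A)$ is the set of filled cells. For $(i,j)\in F(A)$: - the row successor $s_r((i,j))$ is $(i,j+k)$ with $k\ge1$ minimal such that $(i,j+k)\in F(A)$; - the column successor $s_c((i,j))$ is $(i+k,j)$ with $k\ge1$ minimal such that $(i+k,j)\in F(A)$. Given $R=(r_1,\dots,r_n)\in\{-1,1\}^n$ and $C=(c_1,\dots,c_m)\in\{-1,1\}^m$, the move function is $S_{R,C}((i,j))=s_c^{\,c_{j'}}((i,j'))$, where $(i,j')=s_r^{\,r_i}((i,j))$; exponent $-1$ denotes the inverse permutation. $R,C$ is a solution of $P(A)$ if $S_{R,C}$ is a single cycle on $F(A)$, i.e. starting at any filled cell and iterating $S_{R,C}$ visits every filled cell. $P(A)$ has a solution if such $R,C$ exist. For a totally filled array, $S_{R,C}((i,j))=(i+c_{j+r_i},\,j+r_i)$. *)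

(* Defs.v *)
From mathcomp Require Import all_boot all_order all_algebra all_fingroup.

Set Implicit Arguments.
Unset Strict Implicit.
Unset Printing Implicit Defensive.

(* Rows are indexed by 'I_n and columns by 'I_m, read cyclically through
   [ordS] (i |-> i + 1 mod n); representatives are 0, ..., n - 1 instead of
   1, ..., n.  Only the set of filled cells of an array matters, so an array
   is identified with F(A). *)
Definition array (n m : nat) := {set 'I_n * 'I_m}.

Definition totally_filled n m (A : array n m) : Prop :=
  forall c : 'I_n * 'I_m, c \in A.

Definition filled n m (A : array n m) := {c : 'I_n * 'I_m | c \in A}.

Definition step_right n m (c : 'I_n * 'I_m) : 'I_n * 'I_m := (c.1, ordS c.2).
Definition step_down n m (c : 'I_n * 'I_m) : 'I_n * 'I_m := (ordS c.1, c.2).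

Lemma step_right_inj n m : injective (@step_right n m).
Proof.
move=> [i j] [i' j'] e.
by have /= -> := congr1 fst e; have /= /ordS_inj -> := congr1 snd e.
Qed.

Lemma step_down_inj n m : injective (@step_down n m).
Proof.
move=> [i j] [i' j'] e.
by have /= /ordS_inj -> := congr1 fst e; have /= -> := congr1 snd e.
Qed.

Lemma next_filled_ex n m (A : array n m) (t : 'I_n * 'I_m -> 'I_n * 'I_m)
    (t_inj : injective t) (c : filled A) :
  exists k, (0 < k) && (iter k t (val c) \in A).
Proof.
exists (fingraph.order t (val c)).
by rewrite fingraph.order_gt0 iter_order // (valP c).
Qed.

Definition next_dist n m (A : array n m) (t : 'I_n * 'I_m -> 'I_n * 'I_m)
    (t_inj : injective t) (c : filled A) : nat :=
  ex_minn (next_filled_ex t_inj c).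

Lemma next_dist_filled n m (A : array n m) t (t_inj : injective t)
    (c : filled A) :
  iter (next_dist t_inj c) t (val c) \in A.
Proof. by rewrite /next_dist; case: ex_minnP => k /andP[]. Qed.

Definition next_filled n m (A : array n m) t (t_inj : injective t)
    (c : filled A) : filled A :=
  exist _ (iter (next_dist t_inj c) t (val c)) (next_dist_filled t_inj c).

Lemma next_filled_inj n m (A : array n m) t (t_inj : injective t) :
  injective (@next_filled n m A t t_inj).
Proof.
have iter_inj k : injective (iter k t).
  by elim: k => [|k IHk] x y //= /t_inj /IHk.
move=> c d /(congr1 val) /=; rewrite /next_dist.
case: ex_minnP => k /andP[k_gt0 _] k_min.
case: ex_minnP => l /andP[l_gt0 _] l_min.
wlog le_kl : c d k l k_gt0 k_min l_gt0 l_min / k <= l => [IH|].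
  case/orP: (leq_total k l) => le_kl; first exact: IH le_kl.
  by move/esym => e; apply/esym; exact: IH le_kl e.
rewrite -(subnKC le_kl) iterD => /iter_inj e; apply: val_inj; rewrite /= e.
have [->//|lk_gt0] := posnP (l - k).
have := l_min (l - k); rewrite lk_gt0 -e (valP c) => /(_ isT).
by rewrite leqNgt ltn_subrL k_gt0 l_gt0.
Qed.

Definition row_succ n m (A : array n m) : {perm filled A} :=
  perm (@next_filled_inj n m A (@step_right n m) (@step_right_inj n m)).

Definition col_succ n m (A : array n m) : {perm filled A} :=
  perm (@next_filled_inj n m A (@step_down n m) (@step_down_inj n m)).

Definition perm_expz (T : finType) (s : {perm T}) (z : int) : {perm T} :=
  match z with
  | Posz k => (s ^+ k)%g
  | Negz k => (s ^- k.+1)%g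
  end.

Definition sign_vector n (R : 'I_n -> int) : Prop :=
  forall i, (R i = 1 \/ R i = -1)%R.

Definition move_fun n m (A : array n m) (R : 'I_n -> int) (C : 'I_m -> int)
    (c : filled A) : filled A :=
  let c' := perm_expz (row_succ A) (R (val c).1) c in
  perm_expz (col_succ A) (C (val c').2) c'.

Definition single_cycle (T : Type) (f : T -> T) : Prop :=
  forall x y : T, exists k, iter k f x = y.

Definition solution n m (A : array n m) (R : 'I_n -> int) (C : 'I_m -> int) :
    Prop :=
  [/\ sign_vector R, sign_vector C & single_cycle (@move_fun n m A R C)].

Definition has_solution n m (A : array n m) : Prop :=
  exists R C, solution A R C.

(* Main.v *)
Require Import Defs.
From mathcomp Require Import all_boot.
From mathcomp Require Import all_algebra all_fingroup.

(** If [n] and [m] are both even, every move changes both coordinates of a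
    cell by one, so it preserves the parity of [i + j] (well defined on the
    torus) and cannot visit all cells.  If one of the two coordinates has odd
    range, let every move increase it by one, and let the other coordinate
    change by [+1, -1, ..., +1] alternately as the first runs through its
    range: one full turn then shifts the other coordinate by exactly one, so
    the orbit is everything. *)

Set Implicit Arguments.
Unset Strict Implicit.
Unset Printing Implicit Defensive.

Lemma single_cycle_from (T : Type) (f : T -> T) (x0 : T) (p : nat) :
  0 < p -> iter p f x0 = x0 -> (forall y, exists k, iter k f x0 = y) ->
  single_cycle f.
Proof.
move=> p_gt0 px0 reach x y.
have [a <-] := reach x; have [b <-] := reach y.
(* After the [a] steps from [x0] to [x], another [a * p - a] steps complete [a] full periods and
   return to [x0]; then [b] steps lead to [y]. *)
exists (b + (a * p - a)).
rewrite -iterD -addnA subnK ?leq_pmulr // iterD iterM.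
by rewrite (iter_fix _ px0).
Qed.

Lemma val_iter_ordS q k (t : 'I_q) : val (iter k (@ordS q) t) = (t + k) %% q.
Proof.
case: q t => [|q] t; first by case: t.
elim: k => [|k IHk] /=; first by rewrite addn0 modn_small.
by rewrite IHk -addn1 modnDml addn1 addnS.
Qed.

(* The staircase [h 0 t, h 1 (t+1), h 2 t, h 3 (t+1), ...] closes up at
   [h 0 (t+1)] because [p] is odd. *)
Lemma single_cycle_staircase (T : Type) (f : T -> T) (p q : nat)
    (h : 'I_p -> 'I_q -> T) :
  odd p -> 0 < q -> (forall x, exists b t, x = h b t) ->
  (forall b t, f (h b t) = h (ordS b) (if odd b then ord_pred t else ordS t)) ->
  single_cycle f.
Proof.
case: p h => // p h; case: q h => // q h /= p_even _ h_surj fh.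
(* Within one turn the second index is [t] at even positions and [ordS t] at odd ones. *)
have climb k t : k <= p ->
    iter k f (h ord0 t) = h (inord k) (if odd k then ordS t else t).
  elim: k => [|k IHk] k_le.
    by rewrite /=; congr h; apply: val_inj; rewrite /= inordK.
  rewrite iterS IHk; last exact: ltnW.
  rewrite fh inordK; last by rewrite ltnS ltnW.
  congr h.
    by apply: val_inj; rewrite /= !inordK ?ltnS ?(ltnW k_le) // modn_small.
  by rewrite /=; case: (odd k); rewrite /= ?ordSK.
(* The last position [p] is even, so the closing step goes up while the first index wraps to 0. *)
have turn t : iter p.+1 f (h ord0 t) = h ord0 (ordS t).
  rewrite iterS climb // fh inordK // (negbTE p_even); congr h.
  by apply: val_inj; rewrite /= inordK // modnn.
have turns k t : iter (k * p.+1) f (h ord0 t) = h ord0 (iter k (@ordS _) t).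
  by elim: k => // k IHk; rewrite mulSn iterD IHk turn.
have reach0 (t : 'I_q.+1) : iter (t * p.+1) f (h ord0 ord0) = h ord0 t.
  by rewrite turns; congr h; apply: val_inj; rewrite val_iter_ordS add0n modn_small.
apply: (@single_cycle_from _ _ (h ord0 ord0) (q.+1 * p.+1)) => //.
  by rewrite turns; congr h; apply: val_inj; rewrite val_iter_ordS add0n modnn.
move=> y; have [b [t ->]] := h_surj y.
(* For odd [b], the cell [h b t] lies on the turn that starts one level lower, at [ord_pred t]. *)
exists (b + (if odd b then ord_pred t else t) * p.+1).
rewrite iterD reach0 climb -1?ltnS // inord_val.
by case: (odd b); rewrite ?ord_predK.
Qed.

(** The wrap-around from [n - 1] to 0 also flips parity, as [n - 1] is odd. *)
Lemma odd_ordS n (i : 'I_n) : ~~ odd n -> odd (ordS i) = ~~ odd i.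
Proof. by move=> n_even; rewrite /= odd_mod // (negbTE n_even). Qed.

Section TotallyFilled.

Variables (n m : nat) (A : array n m).
Hypothesis fullA : totally_filled A.

Let cell c : filled A := exist _ c (fullA c).

(** The very next cell is filled, so the minimal distance is 1. *)
Lemma val_next_filled t (t_inj : injective t) (c : filled A) :
  val (next_filled t_inj c) = t (val c).
Proof.
rewrite /= /next_dist; case: ex_minnP => k /andP[k_gt0 _] k_min.
have k1 : k <= 1 by apply: k_min; rewrite fullA.
by have -> : k = 1 by apply/eqP; rewrite eqn_leq k1.
Qed.

Lemma row_succE i j : row_succ A (cell (i, j)) = cell (i, ordS j).
Proof. by apply: val_inj; rewrite permE val_next_filled. Qed.

Lemma col_succE i j : col_succ A (cell (i, j)) = cell (ordS i, j).
Proof. by apply: val_inj; rewrite permE val_next_filled. Qed.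

Lemma row_succVE i j : (row_succ A)^-1%g (cell (i, j)) = cell (i, ord_pred j).
Proof. by apply: (canLR (permK _)); rewrite row_succE ord_predK. Qed.

Lemma col_succVE i j : (col_succ A)^-1%g (cell (i, j)) = cell (ord_pred i, j).
Proof. by apply: (canLR (permK _)); rewrite col_succE ord_predK. Qed.

Lemma cell_val (c : filled A) : c = cell ((val c).1, (val c).2).
Proof. by apply: val_inj => /=; case: (val c). Qed.

Let alternating (k : nat) : int := if odd k then (-1)%R else 1%R.

Lemma has_solution_odd_rows : odd n -> 0 < m -> has_solution A.
Proof.
move=> n_odd m_gt0; exists (fun i => alternating i), (fun=> 1%R).
split=> [i|j|]; [by rewrite /alternating; case: odd; [right|left] | by left |].
apply: (@single_cycle_staircase _ _ _ _ (fun i j => cell (i, j))) => //.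
  by move=> c; exists (val c).1, (val c).2; exact: cell_val.
move=> i j; rewrite /move_fun /alternating /=.
by case: (odd i); rewrite /= expg1 ?row_succE ?row_succVE col_succE.
Qed.

Lemma has_solution_odd_cols : odd m -> 0 < n -> has_solution A.
Proof.
(* The column sign is read after the horizontal move, at [ordS j]; the shift by [ord_pred] makes it
   depend on the parity of the starting column [j]. *)
move=> m_odd n_gt0; exists (fun=> 1%R), (fun j => alternating (ord_pred j)).
split=> [i|j|]; [by left | by rewrite /alternating; case: odd; [right|left] |].
apply: (@single_cycle_staircase _ _ _ _ (fun j i => cell (i, j))) => //.
  by move=> c; exists (val c).2, (val c).1; exact: cell_val.
move=> j i; rewrite /move_fun [perm_expz _ 1%R]expg1 row_succE.
rewrite [(val _).2]/= ordSK /alternating.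
by case: (odd j); rewrite /= expg1 ?col_succE ?col_succVE.
Qed.

Lemma perm_expz_flip (T : finType) (s : {perm T}) (z : int) (par : T -> bool) :
  (forall x, par (s x) = ~~ par x) -> (z = 1 \/ z = -1)%R ->
  forall x, par (perm_expz s z x) = ~~ par x.
Proof.
move=> flip [->|->] x /=; rewrite expg1 //.
(* For the inverse, [flip] is applied at the preimage of [x]. *)
by rewrite -{2}(permKV s x) flip negbK.
Qed.

Lemma even_no_solution :
  0 < n -> 0 < m -> ~~ odd n -> ~~ odd m -> ~ has_solution A.
Proof.
move=> n_gt0 m_gt0 n_even m_even [R [C [signR signC cyc]]].
pose par (c : filled A) := odd ((val c).1 + (val c).2).
have row_flip c : par (row_succ A c) = ~~ par c.
  by rewrite (cell_val c) row_succE /par !oddD odd_ordS // addbN.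
have col_flip c : par (col_succ A c) = ~~ par c.
  by rewrite (cell_val c) col_succE /par !oddD odd_ordS // addNb.
have par_move c : par (move_fun R C c) = par c.
  by rewrite /move_fun !perm_expz_flip // negbK.
pose c0 := cell (Ordinal n_gt0, Ordinal m_gt0).
(* The target is a cell of the parity opposite to that of [c0]. *)
have [k ck] := cyc c0 (row_succ A c0).
have : par (iter k (@move_fun _ _ A R C) c0) = par c0.
  by elim: k {ck} => //= k IHk; rewrite par_move.
by rewrite ck row_flip; case: (par c0).
Qed.

End TotallyFilled.

Theorem theorem3p3 (n m : nat) (n_gt0 : 0 < n) (m_gt0 : 0 < m)
    (A : array n m) (fullA : totally_filled A) :
  has_solution A <-> ~ (~~ odd n /\ ~~ odd m).
Proof.
split=> [sol [n_even m_even]|not_even]; first exact: even_no_solution sol.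
have [n_odd|n_even] := boolP (odd n); first exact: has_solution_odd_rows.
have [m_odd|m_even] := boolP (odd m); first exact: has_solution_odd_cols.
by case: not_even.
Qed.
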